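(* Let $2\le n\le\infty$, let $\alpha$ denote the standard $U(n)$-action on $\mathcal{O}_n$, that is, $\alpha_g(s_i):=\sum_{j=1}^n g_{ji}s_j$ for $i=1,\ldots,n$ and $g=(g_{ij})\in U(n)$, and let $\omega$ be a state on $\mathcal{O}_n$. (i) For any $g\in U(n)$, $\mathrm{c}\dim(\omega\circ\alpha_g)=\mathrm{c}\dim\omega$. (ii) For any $g\in U(n)$, $\kappa(\omega\circ\alpha_g)=\kappa(\omega)$.
   Context: For $2\le n\le\infty$, $\mathcal{O}_n$ is the Cuntz algebra with Cuntz generators $s_1,\ldots,s_n$ (a sequence $s_1,s_2,\ldots$ if $n=\infty$): the universal unital C*-algebra generated by elements with $s_i^*s_j=\delta_{ij}I$ and $\sum_{i=1}^n s_is_i^*=I$ if $n<\infty$, respectively $\sum_{i=1}^k s_is_i^*\le I$ for all $k\geq 1$ if $n=\infty$. When $n=\infty$, $\{1,\ldots,n\}$ means $\{1,2,\ldots\}$. $U(n)$ is the rank $n$ unitary group when $n<\infty$, and the group of all unitaries on $\ell^2=\{(z_j)_{j\ge1}:\sum_{j}|z_j|^2<\infty\}$ when $n=\infty$, with matrix entries $g_{ij}$ relative to the standard basis (the sum defining $\alpha_g(s_i)$ then converges in norm). Each $\alpha_g$ extends to a $*$-automorphism of $\mathcal{O}_n$. Let $\mathcal{I}_n=\bigcup_{l\ge0}\{1,\ldots,n\}^l$ be the set of finite words, $\{1,\ldots,n\}^0=\{\emptyset\}$, $s_J=s_{j_1}\cdots s_{j_l}$ for $J=(j_1,\ldots,j_l)$,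 $s_\emptyset=I$. For states $\omega,\omega'$ on $\mathcal{O}_n$, write $\omega\sim\omega'$ if their GNS representations are unitarily equivalent. For a state $\omega$ with GNS representation $(\mathcal{H},\pi,\Omega)$, let $\mathcal{K}(\omega)$ be the closed linear span of $\{\pi(s_J)^*\Omega: J\in\mathcal{I}_n\}$ in $\mathcal{H}$, $\mathrm{c}\dim\omega:=\dim\mathcal{K}(\omega)\in\{1,2,\ldots,\infty\}$ (Hilbert space dimension), and $\kappa(\omega):=\min\{\mathrm{c}\dim\omega':\omega'\text{ a state on }\mathcal{O}_n,\ \omega'\sim\omega\}$. *)

(* Defs.v *)
From HB Require Import structures.
From mathcomp Require Import all_boot all_order all_algebra.
From mathcomp Require Import complex.
From mathcomp Require Import all_classical all_reals all_analysis.
Import Order.TTheory GRing.Theory Num.Theory numFieldNormedType.Exports.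

Set Implicit Arguments.
Unset Strict Implicit.
Unset Printing Implicit Defensive.

Local Open Scope classical_set_scope.
Local Open Scope ring_scope.
Local Open Scope complex_scope.

(* Extended natural numbers, with [None] playing the role of infinity; used
   both for the number of Cuntz generators and for Hilbert space dimensions. *)
Definition enat : Type := option nat.

Definition enat_le (a b : enat) : Prop :=
  match a, b with
  | _, None => True
  | Some k, Some l => (k <= l)%N
  | None, Some _ => False
  end.

(* The least element of [S], the order being a well-order; the default [None]
   is only returned when [S] is empty. *)
Definition enat_min (S : set enat) : enat :=
  xget None [set d | S d /\ forall d', S d' -> enat_le d d'].

(* {1, ..., n} for finite n, {1, 2, ...} for infinite n, numbered from 0. *)
Definition idx (n : enat) : countType :=
  match n with
  | Some m => 'I_m : countType
  | None => nat : countType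
  end.

(* [sum_to F v]: the sum of the family [F] is [v]; when n is infinite the
   series converges to [v] for the topology of [V]. *)
Definition sum_to (K : numFieldType) (V : normedModType K) (n : enat) :
    (idx n -> V) -> V -> Prop :=
  match n with
  | Some m => fun F v => \sum_(i < m) F i = v
  | None => fun F v => series F @ \oo --> v
  end.

(* The ring operations are fields of this mixin because the library has no
   structure joining normed modules and rings below [numDomainType]. *)
HB.mixin Record isCStarAlgebra (R : realType) A
    of CompleteNormedModule R[i] A := {
  cunit : A;
  cmul : A -> A -> A;
  star : A -> A;
  cmulA : associative cmul;
  cmul1l : left_id cunit cmul;
  cmul1r : right_id cunit cmul;
  cmulDl : left_distributive cmul +%R;
  cmulDr : right_distributive cmul +%R;
  cmulZl : forall (k : R[i]) a b, cmul (k *: a) b = k *: cmul a b;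
  cmulZr : forall (k : R[i]) a b, cmul a (k *: b) = k *: cmul a b;
  starD : forall a b, star (a + b) = star a + star b;
  starZ : forall (k : R[i]) a, star (k *: a) = k^* *: star a;
  starM : forall a b, star (cmul a b) = cmul (star b) (star a);
  starK : involutive star;
  cstar_normM : forall a b, `|cmul a b| <= `|a| * `|b|;
  cstar_identity : forall a, `|cmul (star a) a| = `|a| ^+ 2
}.

(* Unital C*-algebras. *)
#[short(type="cstarAlgType")]
HB.structure Definition CStarAlgebra (R : realType) :=
  {A of CompleteNormedModule R[i] A & isCStarAlgebra R A}.

Notation "a ** b" := (cmul a b) (at level 40, left associativity) : ring_scope.

HB.mixin Record isHilbert (R : realType) H
    of CompleteNormedModule R[i] H := {
  dotp : H -> H -> R[i];
  dotpDl : forall x y z, dotp (x + y) z = dotp x z + dotp y z;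
  dotpZl : forall (k : R[i]) x y, dotp (k *: x) y = k * dotp x y;
  dotpC : forall x y, dotp y x = (dotp x y)^*;
  dotp_norm : forall x : H, dotp x x = `|x| ^+ 2
}.

#[short(type="hilbertType")]
HB.structure Definition Hilbert (R : realType) :=
  {H of CompleteNormedModule R[i] H & isHilbert R H}.

Section ClosedSpan.
Variables (K : numFieldType) (V : normedModType K).

Definition is_subspace (S : set V) : Prop :=
  S 0 /\ forall (k : K) x y, S x -> S y -> S (k *: x + y).

Definition closed_span (X : set V) : set V :=
  smallest [set S | is_subspace S /\ closed S] X.

End ClosedSpan.

Section HilbertDimension.
Variables (R : realType) (H : hilbertType R).

(* [d] is the cardinality of an orthonormal basis of the closed subspace [K].
   Only countable dimensions are covered, and [None] means countably infinite;
   this suffices for separable spaces. *)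
Definition has_hilbert_dim (K : set H) (d : enat) : Prop :=
  exists e : idx d -> H,
    (forall i j, dotp (e i) (e j) = (i == j)%:R) /\ closed_span (range e) = K.

End HilbertDimension.

Section StarMaps.
Variables (R : realType) (A B : cstarAlgType R).

(* Unital *-homomorphisms. *)
Definition is_star_hom (f : A -> B) : Prop :=
  [/\ forall (k : R[i]) a b, f (k *: a + b) = k *: f a + f b,
      forall a b, f (a ** b) = f a ** f b,
      f cunit = cunit &
      forall a, f (star a) = star (f a)].

End StarMaps.

Definition is_star_aut (R : realType) (A : cstarAlgType R) (f : A -> A) : Prop :=
  is_star_hom f /\ bijective f.

Section States.
Variables (R : realType) (A : cstarAlgType R).

Definition cstar_le (a b : A) : Prop := exists c : A, b - a = star c ** c.

Definition is_state (omega : A -> R[i]) : Prop :=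
  [/\ forall (k : R[i]) a b, omega (k *: a + b) = k * omega a + omega b,
      forall a, 0 <= omega (star a ** a) &
      omega cunit = 1].

(* The fourth clause says that [pi (star a)] is the adjoint of [pi a]. *)
Definition is_star_rep (H : hilbertType R) (pi : A -> H -> H) : Prop :=
  [/\ forall a, continuous (pi a) /\
        forall (k : R[i]) x y, pi a (k *: x + y) = k *: pi a x + pi a y,
      forall (k : R[i]) a b x, pi (k *: a + b) x = k *: pi a x + pi b x,
      forall a b x, pi (a ** b) x = pi a (pi b x),
      forall a x y, dotp (pi a x) y = dotp x (pi (star a) y) &
      forall x, pi cunit x = x].

Definition is_gns (omega : A -> R[i]) (H : hilbertType R)
    (pi : A -> H -> H) (Omega : H) : Prop :=
  [/\ is_star_rep pi,
      dense (range (fun a => pi a Omega)) &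
      forall a, omega a = dotp (pi a Omega) Omega].

Definition unitarily_equivalent (H1 H2 : hilbertType R)
    (pi1 : A -> H1 -> H1) (pi2 : A -> H2 -> H2) : Prop :=
  exists U : H1 -> H2,
    [/\ forall (k : R[i]) x y, U (k *: x + y) = k *: U x + U y,
        forall x y, dotp (U x) (U y) = dotp x y,
        forall y, exists x, U x = y &
        forall a x, U (pi1 a x) = pi2 a (U x)].

(* GNS triples of a given state exist and are unique up to unitary
   equivalence, so the choice of triples is immaterial. *)
Definition state_equiv (omega omega' : A -> R[i]) : Prop :=
  exists (H H' : hilbertType R) (pi : A -> H -> H) (pi' : A -> H' -> H')
         (Omega : H) (Omega' : H'),
    [/\ is_gns omega pi Omega, is_gns omega' pi' Omega' &
        unitarily_equivalent pi pi'].

End States.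

Section CuntzAlgebra.
Variables (R : realType) (n : enat).

Definition cuntz_relations (A : cstarAlgType R) (s : idx n -> A) : Prop :=
  (forall i j, star (s i) ** s j = if i == j then cunit else 0) /\
  match n return (idx n -> A) -> Prop with
  | Some m => fun s => \sum_(i < m) s i ** star (s i) = cunit
  | None => fun s => forall k : nat, cstar_le (\sum_(i < k) s i ** star (s i)) cunit
  end s.

Definition generates (A : cstarAlgType R) (s : idx n -> A) : Prop :=
  smallest
    [set S : set A | [/\ is_subspace S, closed S, S cunit,
       forall a b, S a -> S b -> S (a ** b) & forall a, S a -> S (star a)]]
    (range s) = setT.

(* The Cuntz algebra on n generators is only defined up to isomorphism:
   [(A, s)] is a universal unital C*-algebra for the Cuntz relations. *)
Definition is_cuntz_algebra (A : cstarAlgType R) (s : idx n -> A) : Prop :=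
  [/\ cuntz_relations s, generates s &
      forall (B : cstarAlgType R) (t : idx n -> B), cuntz_relations t ->
        exists f : A -> B, is_star_hom f /\ forall i, f (s i) = t i].

End CuntzAlgebra.

Section UnitaryGroup.
Variable R : realType.

(* Membership in l^2. *)
Definition ell2 (z : nat -> R[i]) : Prop :=
  cvgn (series (fun j => `|z j| ^+ 2 : R[i]^o)).

Definition ell2_dot (x y : nat -> R[i]) : R[i] :=
  limn (series (fun j => x j * (y j)^* : R[i]^o)).

(* Unitary operators on l^2: surjective linear maps preserving the inner
   product.  The values of [u] outside l^2 are irrelevant. *)
Definition is_ell2_unitary (u : (nat -> R[i]) -> (nat -> R[i])) : Prop :=
  [/\ forall x, ell2 x -> ell2 (u x),
      forall (k : R[i]) x y, ell2 x -> ell2 y ->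
        forall j, u (fun l => k * x l + y l) j = k * u x j + u y j,
      forall x y, ell2 x -> ell2 y -> ell2_dot (u x) (u y) = ell2_dot x y &
      forall y, ell2 y -> exists2 x, ell2 x & u x = y].

Definition unitary_group (n : enat) : Type :=
  match n with
  | Some m => {g : 'M[R[i]]_m | g \is unitarymx}
  | None => {u : (nat -> R[i]) -> (nat -> R[i]) | is_ell2_unitary u}
  end.

(* The matrix entry g_ij relative to the standard basis. *)
Definition entry (n : enat) : unitary_group n -> idx n -> idx n -> R[i] :=
  match n return unitary_group n -> idx n -> idx n -> R[i] with
  | Some m => fun g i j => sval g i j
  | None => fun g i j => sval g (fun k => (k == j)%:R) i
  end.

(* alpha_g is the *-automorphism with alpha_g (s_i) = sum_j g_ji s_j; it is
   determined by this because the s_i generate [A]. *)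
Definition is_standard_action (n : enat) (A : cstarAlgType R) (s : idx n -> A)
    (alpha : unitary_group n -> A -> A) : Prop :=
  forall g, is_star_aut (alpha g) /\
    forall i, sum_to (fun j => entry g j i *: s j) (alpha g (s i)).

End UnitaryGroup.

Section CorrelationDimension.
Variables (R : realType) (n : enat) (A : cstarAlgType R) (s : idx n -> A).

Definition word_prod (J : seq (idx n)) : A := foldr (fun j a => s j ** a) cunit J.

(* [pi (star (word_prod J))] is the adjoint of [pi (word_prod J)]. *)
Definition corr_space (H : hilbertType R) (pi : A -> H -> H) (Omega : H) :
    set H :=
  closed_span (range (fun J => pi (star (word_prod J)) Omega)).

(* By uniqueness of GNS triples, exactly one [d] has the required property; it
   exists because the space is separable, there being countably many words. *)
Definition cdim (omega : A -> R[i]) : enat :=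
  xget None [set d | exists (H : hilbertType R) (pi : A -> H -> H) (Omega : H),
    is_gns omega pi Omega /\ has_hilbert_dim (corr_space pi Omega) d].

Definition kappa (omega : A -> R[i]) : enat :=
  enat_min [set cdim omega' | omega' in
    [set omega' | is_state omega' /\ state_equiv omega' omega]].

End CorrelationDimension.

(* Main.v *)
Require Import Defs.
From mathcomp Require Import all_boot all_order all_algebra.
From mathcomp Require Import complex.
From mathcomp Require Import all_classical all_reals all_analysis.
Import Order.TTheory GRing.Theory Num.Theory numFieldNormedType.Exports.

(** Composing a GNS representation [pi] of [omega] with the automorphism
    [alpha g] gives a GNS representation of [omega \o alpha g] on the same
    space with the same cyclic vector, and composing with the inverse of
    [alpha g] goes back ([gns_comp]).  The correlation space of the new triple
    is built with [pi] from the words in [t_i = alpha g (s_i)] instead of the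
    words in [s_i], so (i) follows once these two closed spans are equal
    ([corr_space_unitary_mix]).

    The correlation space of a family [t] is the least closed subspace that
    contains the cyclic vector and is stable under all [pi (star (t_j))]
    ([corr_space_invariant], [corr_space_min]).  So it is enough that a closed
    subspace stable under the [pi (star (s_j))] is stable under the
    [pi (star (t_i))], and conversely.  For finitely many generators this is
    clear, [t_i] being a linear combination of the [s_j] and [s_i] one of the
    [t_j].  For infinitely many generators the expansion
    [u = sum_j c_j t_j] has to be approximated inside the representation, and
    [is_star_rep] gives no norm bound on [pi].  It is replaced by an exact
    computation: if the [t_j] are isometries with orthogonal ranges, [u] is an
    isometry and [star (t_j) ** u = c_j], then the residual [r] of [u] after
    finitely many terms satisfies [star r ** r = 1 - sum_F |c_j|^2], a scalar
    ([residual_square]), and for such an [r] the norm of [pi (star r)] can be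
    read off from the inner product ([rep_star_bound]).  As [sum_j |c_j|^2 = 1],
    the residuals tend to 0 ([invariant_of_expansion]).

    The coefficients are [c_j = g_ji] for [u = t_i], [t = s], and the conjugate
    of [g_ij] for [u = s_i]; that they are square summable with sum 1 says
    that the columns and the rows of [g] are unit vectors ([entry_col_norm],
    [entry_row_norm]).

    For (ii), pulling back along [alpha g] is a bijection from the states
    equivalent to [omega] to those equivalent to [omega \o alpha g], and by (i)
    it preserves the correlation dimension ([kappa_comp]). *)

Set Implicit Arguments.
Unset Strict Implicit.
Unset Printing Implicit Defensive.

Local Open Scope classical_set_scope.
Local Open Scope ring_scope.
Local Open Scope complex_scope.

(** * Possibly infinite sums *)

Section SumTo.
Context {K : numFieldType} {n : enat}.

Lemma series_single (V : normedModType K) (F : nat -> V) i :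
  (forall j, j != i -> F j = 0) -> series F @ \oo --> F i.
Proof.
move=> F0; apply: cvg_near_cst; exists i.+1 => // k /= ik.
rewrite /series /= big_mkord (bigD1 (Ordinal ik)) //= big1 ?addr0 // => j ji.
exact: F0.
Qed.

Lemma sum_to_approx (V : normedModType K) (F : idx n -> V) (v : V) :
  sum_to F v -> forall e : K, 0 < e ->
  exists2 r : seq (idx n), uniq r & `|v - \sum_(j <- r) F j| < e.
Proof.
case: n F => [m|] F /= Fv e e0.
  exists (index_enum 'I_m); first exact: index_enum_uniq.
  by rewrite Fv subrr normr0.
have /cvgrPdist_lt /(_ e e0) [N _ /(_ N (leqnn N)) /= FN] := Fv.
by exists (index_iota 0 N); first exact: iota_uniq.
Qed.

Lemma sum_to_single (V : normedModType K) (F : idx n -> V) (v : V) i :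
  sum_to F v -> (forall j, j != i -> F j = 0) -> v = F i.
Proof.
case: n F i => [m|] F i /= Fv F0.
  by rewrite -Fv (bigD1 i) //= big1 ?addr0.
by apply: (cvg_unique _ Fv) => //; exact: series_single.
Qed.

Lemma sum_to_map (V W : normedModType K) (f : V -> W) (F : idx n -> V) (v : V) :
  (forall a b, f (a + b) = f a + f b) -> f 0 = 0 -> continuous f ->
  sum_to F v -> sum_to (f \o F) (f v).
Proof.
move=> fD f0 fC; case: n F => [m|] F /= Fv.
  by rewrite -Fv (big_morph f fD f0).
have -> : series (f \o F) = f \o series F.
  by apply/funext => k; rewrite /series /= (big_morph f fD f0).
by apply: cvg_comp Fv _; exact: fC.
Qed.

End SumTo.

(** * Algebra in a C*-algebra *)

Section CStarCalculus.
Context {R : realType} {A : cstarAlgType R}.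
Implicit Types a b : A.

Lemma cmulr0 a : a ** 0 = 0.
Proof. by apply: (addrI (a ** 0)); rewrite -cmulDr !addr0. Qed.

Lemma cmul0r a : 0 ** a = 0.
Proof. by apply: (addrI (0 ** a)); rewrite -cmulDl !addr0. Qed.

Lemma cmulrN a b : a ** (- b) = - (a ** b).
Proof. by apply: (addrI (a ** b)); rewrite -cmulDr !subrr cmulr0. Qed.

Lemma cmulNr a b : (- a) ** b = - (a ** b).
Proof. by apply: (addrI (a ** b)); rewrite -cmulDl !subrr cmul0r. Qed.

Lemma cmul_sumr (I : Type) (r : seq I) a (F : I -> A) :
  a ** (\sum_(i <- r) F i) = \sum_(i <- r) a ** F i.
Proof. exact: (big_morph (cmul a) (cmulDr a) (cmulr0 a)). Qed.

Lemma star0 : star 0 = 0 :> A.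
Proof. by apply: (addrI (star 0)); rewrite -starD !addr0. Qed.

Lemma starB a b : star (a - b) = star a - star b.
Proof.
rewrite starD; congr (_ + _).
by apply: (addrI (star b)); rewrite -starD !subrr star0.
Qed.

Lemma star_sum (I : Type) (r : seq I) (F : I -> A) :
  star (\sum_(i <- r) F i) = \sum_(i <- r) star (F i).
Proof. exact: (big_morph star starD star0). Qed.

Lemma star1 : star cunit = cunit :> A.
Proof.
rewrite -[RHS]starK -[in RHS](cmul1l (star cunit)) starM starK.
by rewrite cmul1l.
Qed.

Lemma cmul_continuous a : continuous (cmul a).
Proof.
move=> b; apply/cvgrPdist_lt => e e0.
have a1 : 0 < `|a| + 1 :> R[i] by rewrite ltr_wpDl.
near=> c; rewrite -cmulrN -cmulDr (le_lt_trans (cstar_normM _ _)) //.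
apply: (@le_lt_trans _ _ ((`|a| + 1) * `|b - c|)).
  by rewrite ler_wpM2r // lerDl.
rewrite mulrC -ltr_pdivlMr //.
near: c; apply: (@cvgr_dist_lt _ _ _ (nbhs b) _ id b) => //.
exact: divr_gt0.
Unshelve. all: by end_near. Qed.

End CStarCalculus.

(** * Closed spans *)

Section ClosedSpanLemmas.
Context {K : numFieldType}.

Lemma closed_span_subspace {V : normedModType K} (X : set V) :
  is_subspace (closed_span X).
Proof.
split=> [S [[[S0 _] _] _]//|k x y xX yX S SP].
by have [[[_ SD] _] _] := SP; apply: SD; [exact: xX SP | exact: yX SP].
Qed.

Lemma closed_span_closed {V : normedModType K} (X : set V) :
  closed (closed_span X).
Proof. by apply: closed_bigI => S [[]]. Qed.

Lemma closed_span_preimage {V W : normedModType K} (f : V -> W)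
    (X : set V) (L : set W) :
  continuous f -> (forall (k : K) x y, f (k *: x + y) = k *: f x + f y) ->
  is_subspace L -> closed L -> X `<=` f @^-1` L ->
  closed_span X `<=` f @^-1` L.
Proof.
move=> fC flin [L0 LD] Lc XL; apply: smallest_sub => //=; split; last first.
  by move/continuous_closedP: fC; exact.
split=> [|k x y Lx Ly] /=; last by rewrite flin; exact: LD.
have := flin 0 0 0; rewrite !scale0r !add0r => f0.
by have := flin (-1) 0 0; rewrite !scaler0 !addr0 !scaleN1r addNr => ->.
Qed.

Lemma subspace_sum {V : normedModType K} (L : set V) (I : Type) (r : seq I)
    (F : I -> V) :
  is_subspace L -> (forall i, L (F i)) -> L (\sum_(i <- r) F i).
Proof.
move=> [L0 LD] LF; apply: (big_ind L) => // x y Lx Ly.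
by rewrite -[x]scale1r; exact: LD.
Qed.

Lemma closed_approx {V : normedModType K} (L : set V) (x : V) :
  closed L -> (forall e : K, 0 < e -> exists2 y, L y & `|x - y| < e) -> L x.
Proof.
move=> Lc appr; apply: Lc => B /nbhs_ballP [e /= e0 eB].
have [y Ly xy] := appr e e0; exists y; split => //; apply: eB.
by rewrite -ball_normE.
Qed.

End ClosedSpanLemmas.

(** * Star representations *)

Section InnerProduct.
Context {R : realType} {H : hilbertType R}.
Implicit Types x y z : H.

Lemma dotp0r x : dotp x 0 = 0.
Proof. by rewrite dotpC -(scale0r (0 : H)) dotpZl mul0r conjc0. Qed.

Lemma dotpBl x y z : dotp (x - y) z = dotp x z - dotp y z.
Proof. by rewrite dotpDl -scaleN1r dotpZl mulN1r. Qed.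

Lemma dotpBr x y z : dotp z (x - y) = dotp z x - dotp z y.
Proof. by rewrite dotpC dotpBl rmorphB /= -!dotpC. Qed.

End InnerProduct.

Section Representations.
Context {R : realType} {A : cstarAlgType R} {H : hilbertType R}.
Context { pi : A -> H -> H} (hpi : is_star_rep pi).

Let pi_lin a (k : R[i]) x y : pi a (k *: x + y) = k *: pi a x + pi a y.
Proof. by case: hpi => h _ _ _ _; case: (h a). Qed.

Let pi_linl (k : R[i]) a b x : pi (k *: a + b) x = k *: pi a x + pi b x.
Proof. by case: hpi. Qed.

Let piM a b x : pi (a ** b) x = pi a (pi b x).
Proof. by case: hpi. Qed.

Let pi_adj a x y : dotp (pi a x) y = dotp x (pi (star a) y).
Proof. by case: hpi. Qed.

Let pi1 x : pi cunit x = x.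
Proof. by case: hpi. Qed.

Let piD a b x : pi (a + b) x = pi a x + pi b x.
Proof. by have := pi_linl 1 a b x; rewrite !scale1r. Qed.

Let pi0 x : pi 0 x = 0.
Proof. by have := pi_linl (-1) 0 0 x; rewrite !scaler0 !addr0 scaleN1r addNr. Qed.

Lemma repZ (k : R[i]) a x : pi (k *: a) x = k *: pi a x.
Proof. by have := pi_linl k a 0 x; rewrite !addr0 pi0 addr0. Qed.

Lemma repB a b x : pi (a - b) x = pi a x - pi b x.
Proof. by rewrite piD -scaleN1r repZ scaleN1r. Qed.

Lemma rep_sum (I : Type) (r : seq I) (F : I -> A) x :
  pi (\sum_(i <- r) F i) x = \sum_(i <- r) pi (F i) x.
Proof. by apply: (big_morph (pi^~ x)) => // a b; exact: piD. Qed.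

(** Automatic continuity in the one case where it is elementary: with
    [T = pi r] and [S] its adjoint, the hypothesis says [S T = c], so [T S] is
    [c] times a projection, and expanding [0 <= |c x - T S x|^2] yields
    [|S x|^2 <= c |x|^2].  The absolute value in the bound spares users a
    proof that [c] is nonnegative, which can fail on the zero space. *)
Lemma rep_star_bound (r : A) (c : R[i]) (x : H) :
  star r ** r = c *: cunit -> `|pi (star r) x| ^+ 2 <= `|c| * `|x| ^+ 2.
Proof.
move=> rr; have [->|x0] := eqVneq x 0.
  suff -> : pi (star r) 0 = 0 by rewrite normr0 !expr0n mulr0.
  by have := pi_lin (star r) (-1) 0 0; rewrite !scaler0 !addr0 scaleN1r addNr.
have pir_norm y : `|pi r y| ^+ 2 = c * `|y| ^+ 2.
  rewrite -!dotp_norm -[in X in dotp _ X](starK r) -pi_adj -piM rr.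
  by rewrite repZ pi1 dotpZl.
have c_ge0 : 0 <= c.
  have : 0 <= `|pi r x| ^+ 2 by exact: exprn_ge0.
  rewrite pir_norm.
  by rewrite pmulr_lge0 // exprn_gt0 // normr_gt0.
rewrite (ger0_norm c_ge0); set z := pi (star r) x.
have xrz : dotp x (pi r z) = `|z| ^+ 2.
  by rewrite -dotp_norm {2}/z pi_adj starK.
(* The expansion only gives c (c |x|^2 - |z|^2) >= 0, so c = 0 is separate. *)
have [c0|c_gt0] := eqVneq c 0.
  have : `|pi r z| ^+ 2 = 0 by rewrite pir_norm c0 mul0r.
  move/eqP; rewrite sqrf_eq0 normr_eq0 => /eqP rz0.
  by rewrite -xrz rz0 dotp0r c0 mul0r.
have cxrz : dotp (c *: x) (pi r z) = c * `|z| ^+ 2 by rewrite dotpZl xrz.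
have rzcx : dotp (pi r z) (c *: x) = c * `|z| ^+ 2.
  by rewrite dotpC cxrz; apply: geC0_conj; rewrite mulr_ge0 // exprn_ge0.
have : 0 <= `|c *: x - pi r z| ^+ 2 by exact: exprn_ge0.
rewrite -dotp_norm dotpBl !dotpBr rzcx cxrz !dotp_norm pir_norm.
rewrite normrZ (ger0_norm c_ge0) subrr subr0 exprMn expr2 -mulrA -mulrBr.
by rewrite pmulr_rge0 ?subr_ge0 // lt_def c_gt0.
Qed.

End Representations.

(** * Isometries with orthogonal ranges *)

Section Isometries.
Context {R : realType} {n : enat} {A : cstarAlgType R}.

Definition orthogonal_isometries (t : idx n -> A) : Prop :=
  forall i j, star (t i) ** t j = if i == j then cunit else 0.

(** The hypothesis on [star (t j) ** u] makes [r] orthogonal to the [t j] with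
    [j] in [F], so [star r ** r = star u ** r], and this is the Pythagorean
    (Bessel) identity with values in the scalar multiples of the unit. *)
Lemma residual_square (t : idx n -> A) (u : A) (c : idx n -> R[i])
    (F : seq (idx n)) :
  orthogonal_isometries t -> star u ** u = cunit ->
  (forall j, star (t j) ** u = c j *: cunit) -> uniq F ->
  let r := u - \sum_(j <- F) c j *: t j in
  star r ** r = (1 - \sum_(j <- F) `|c j| ^+ 2) *: cunit.
Proof.
move=> tt uu tu Funiq r.
have tr k : k \in F -> star (t k) ** r = 0.
  move=> kF; rewrite cmulDr cmulrN cmul_sumr tu (bigD1_seq k) //= big1.
    by rewrite addr0 cmulZr tt eqxx subrr.
  by move=> j /negbTE jk; rewrite cmulZr tt eq_sym jk scaler0.
have -> : star r ** r = star u ** r.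
  rewrite {1}/r starB cmulDl star_sum cmulNr.
  rewrite [X in _ - X](_ : _ = 0) ?subr0 //.
  rewrite (big_morph (cmul^~ r) (fun a b => cmulDl a b r) (cmul0r r)).
  by rewrite big_seq big1 // => j jF; rewrite starZ cmulZl tr ?scaler0.
rewrite cmulDr cmulrN uu cmul_sumr scalerBl scale1r scaler_suml.
congr (_ - _); apply: eq_bigr => j _.
rewrite cmulZr -[star u ** t j]starK starM starK tu starZ star1 scalerA.
by rewrite sqr_normc.
Qed.

(** Parseval's equality for the coefficients [c] forces [u] to be the limit of
    its partial expansions in the [t j]; the adjoints of the partial expansions
    preserve [L], and they converge strongly by [rep_star_bound] applied to the
    residuals. *)
Lemma invariant_of_expansion (H : hilbertType R) (pi : A -> H -> H)
    (t : idx n -> A) (u : A) (c : idx n -> R[i]) (L : set H) :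
  is_star_rep pi -> orthogonal_isometries t -> star u ** u = cunit ->
  (forall j, star (t j) ** u = c j *: cunit) ->
  sum_to (fun j => `|c j| ^+ 2 : R[i]^o) 1 ->
  is_subspace L -> closed L ->
  (forall j x, L x -> L (pi (star (t j)) x)) ->
  forall x, L x -> L (pi (star u) x).
Proof.
move=> hpi tt uu tu c1 Lsub Lc Lt x Lx.
apply: closed_approx => // e e0.
(* The residual is bounded by a multiple of |x|^2; adding 1 allows x = 0. *)
have x1 : 0 < `|x| ^+ 2 + 1 by rewrite ltr_wpDl // exprn_ge0.
have d0 : 0 < e ^+ 2 / (`|x| ^+ 2 + 1) by rewrite divr_gt0 // exprn_gt0.
have [F Funiq Fe] := sum_to_approx c1 d0.
exists (pi (star (\sum_(j <- F) c j *: t j)) x).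
  rewrite star_sum (rep_sum hpi); apply: subspace_sum => // j.
  rewrite starZ (repZ hpi); case: Lsub => L0 LD.
  by rewrite -[X in L X]addr0; apply: LD => //; exact: Lt.
rewrite -(repB hpi) -starB -(@ltr_pXn2r _ 2) ?nnegrE ?(ltW e0) //.
apply: le_lt_trans (rep_star_bound hpi x (residual_square tt uu tu Funiq)) _.
apply: (@le_lt_trans _ _ (`|1 - \sum_(j <- F) `|c j| ^+ 2| * (`|x| ^+ 2 + 1))).
  by rewrite ler_wpM2l // lerDl.
by rewrite -ltr_pdivlMr.
Qed.

End Isometries.

(** * Matrix entries of a unitary *)

Section Entries.
Context {R : realType}.

Definition delta (i : nat) : nat -> R[i] := fun k => (k == i)%:R.

Lemma ell2_delta i : ell2 (delta i).
Proof.
apply: cvgP; apply: (@series_single _ R[i]^o _ i) => j /negbTE ji.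
by rewrite /delta ji normr0 expr0n.
Qed.

Lemma ell2_dot_delta_r x i : ell2_dot x (delta i) = x i.
Proof.
have dii : conjc (delta i i) = 1 by rewrite /delta eqxx; exact: conjc1.
rewrite -[RHS]mulr1 -dii; apply: (@cvg_lim R[i]^o) => //.
apply: (@series_single _ R[i]^o (fun j => x j * conjc (delta i j))) => j /negbTE ji.
by rewrite /delta ji conjc0 mulr0.
Qed.

Lemma ell2_dot_delta_l x i : ell2_dot (delta i) x = (x i)^*.
Proof.
have -> : (x i)^* = delta i i * (x i)^* by rewrite /delta eqxx mul1r.
apply: (@cvg_lim R[i]^o) => //.
apply: (@series_single _ R[i]^o (fun j => delta i j * (x j)^*)) => j /negbTE ji.
by rewrite /delta ji mul0r.
Qed.

Lemma ell2_norm_sum (z : nat -> R[i]) : ell2 z ->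
  series (fun j => `|z j| ^+ 2 : R[i]^o) @ \oo --> (ell2_dot z z : R[i]^o).
Proof.
move=> hz; rewrite /ell2_dot.
suff -> : (fun j => z j * (z j)^* : R[i]^o) = (fun j => `|z j| ^+ 2 : R[i]^o).
  exact: hz.
by apply/funext => j; rewrite sqr_normc.
Qed.

Lemma ell2_dot_delta i : ell2_dot (delta i) (delta i) = 1.
Proof. by rewrite ell2_dot_delta_r /delta eqxx. Qed.

Lemma entry_col_norm (n : enat) (g : unitary_group R n) (i : idx n) :
  sum_to (fun j => `|entry g j i| ^+ 2 : R[i]^o) 1.
Proof.
case: n g i => [m|] [u hu] i /=.
  have := hu; rewrite -trmx_unitary => /unitarymxP /matrixP /(_ i i).
  rewrite !mxE eqxx => gg; apply: etrans gg; apply: eq_bigr => j _; rewrite !mxE.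
  exact: normCK.
have [u2 _ udot _] := hu.
have := ell2_norm_sum (u2 _ (@ell2_delta i)).
by rewrite udot ?ell2_dot_delta //; exact: ell2_delta.
Qed.

(** A row of a unitary [u] of l^2 is not a value of [u].  Instead
    [u_ij = <u e_j, e_i> = <u e_j, u v> = <e_j, v>] is the conjugate of [v_j],
    where [v] is the preimage of [e_i]; thus surjectivity of [u] replaces the
    adjoint. *)
Lemma entry_row_norm (n : enat) (g : unitary_group R n) (i : idx n) :
  sum_to (fun j => `|entry g i j| ^+ 2 : R[i]^o) 1.
Proof.
case: n g i => [m|] [u hu] i /=.
  have := hu => /unitarymxP /matrixP /(_ i i).
  rewrite !mxE eqxx => gg; apply: etrans gg; apply: eq_bigr => j _; rewrite !mxE.
  exact: normCK.
have [u2 _ udot usurj] := hu.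
have [v v2 uv] := usurj _ (@ell2_delta i).
have entryE j : u (delta j) i = (v j)^*.
  have <- := ell2_dot_delta_l v j; have := udot _ _ (@ell2_delta j) v2.
  by rewrite uv ell2_dot_delta_r.
have := ell2_norm_sum v2; rewrite -(udot _ _ v2 v2) uv ell2_dot_delta.
have -> : (fun j => `|v j| ^+ 2 : R[i]^o) =
          (fun j => `|u (fun k => (k == j)%:R) i| ^+ 2 : R[i]^o).
  by apply/funext => j; rewrite -normcJ -entryE.
by [].
Qed.

End Entries.

(** * The correlation space of a family of isometries *)

Section CorrelationSpace.
Context {R : realType} {n : enat} {A : cstarAlgType R} {H : hilbertType R}.
Context { pi : A -> H -> H} (hpi : is_star_rep pi) (Omega : H).

Lemma corr_space_vacuum (t : idx n -> A) : corr_space t pi Omega Omega.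
Proof.
apply: sub_gen_smallest; exists [::] => //=; rewrite star1.
by case: hpi => _ _ _ _ ->.
Qed.

Lemma corr_space_invariant (t : idx n -> A) i x :
  corr_space t pi Omega x -> corr_space t pi Omega (pi (star (t i)) x).
Proof.
have [piCL _ piM _ _] := hpi; have [piC pi_lin] := piCL (star (t i)).
apply: (closed_span_preimage piC pi_lin (closed_span_subspace _)).
  exact: closed_span_closed.
move=> _ [J _ <-] /=; apply: sub_gen_smallest; exists (rcons J i) => //.
rewrite -piM -starM; congr (pi (star _) _).
by elim: J => [|j J IH] /=; rewrite ?cmul1r ?cmul1l // IH cmulA.
Qed.

Lemma corr_space_min (t : idx n -> A) (L : set H) :
  is_subspace L -> closed L -> L Omega ->
  (forall i x, L x -> L (pi (star (t i)) x)) -> corr_space t pi Omega `<=` L.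
Proof.
move=> Lsub Lc LO Lt; apply: smallest_sub => // _ [J _ <-].
have [_ _ piM _ pi1] := hpi.
elim: J Omega LO => [|j J IH] x Lx /=; first by rewrite star1 pi1.
by rewrite starM piM; apply: IH; exact: Lt.
Qed.

(** The index convention is [s i = sum_j (c i j) (t j)]. *)
Lemma corr_space_sub_of_expansion (s t : idx n -> A)
    (c : idx n -> idx n -> R[i]) :
  orthogonal_isometries s -> orthogonal_isometries t ->
  (forall i j, star (t j) ** s i = c i j *: cunit) ->
  (forall i, sum_to (fun j => `|c i j| ^+ 2 : R[i]^o) 1) ->
  corr_space s pi Omega `<=` corr_space t pi Omega.
Proof.
move=> ss tt ts c1.
have tsub : is_subspace (corr_space t pi Omega) by exact: closed_span_subspace.
have tcl : closed (corr_space t pi Omega) by exact: closed_span_closed.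
apply: corr_space_min => //; first exact: corr_space_vacuum.
move=> i; apply: (invariant_of_expansion hpi tt _ (ts i)) => //.
  by rewrite ss eqxx.
by move=> j x; exact: corr_space_invariant.
Qed.

(** Orthogonality of the [s j] reads off the coefficients of [t i], and taking
    adjoints gives the coefficients of [s j] along the [t i].  That
    these coefficients do expand [s j] follows from the unit rows of [g]. *)
Lemma corr_space_unitary_mix (g : unitary_group R n) (s t : idx n -> A) :
  orthogonal_isometries s -> orthogonal_isometries t ->
  (forall i, sum_to (fun j => entry g j i *: s j) (t i)) ->
  corr_space t pi Omega = corr_space s pi Omega.
Proof.
move=> ss tt ts.
have st i j : star (s j) ** t i = entry g j i *: cunit.
  have := sum_to_map (@cmulDr R A (star (s j))) (cmulr0 _)
            (@cmul_continuous _ _ _) (ts i).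
  move=> /(@sum_to_single _ _ _ _ _ j) /= ->; first by rewrite cmulZr ss eqxx.
  by move=> k /negbTE kj; rewrite cmulZr ss eq_sym kj scaler0.
have ts' i j : star (t j) ** s i = (entry g i j)^* *: cunit.
  by rewrite -[star (t j) ** s i]starK starM starK st starZ star1.
apply/seteqP; split.
  by apply: (corr_space_sub_of_expansion tt ss st) => i; exact: entry_col_norm.
apply: (corr_space_sub_of_expansion ss tt ts') => i.
have -> : (fun j => `|(entry g i j)^*| ^+ 2 : R[i]^o) =
          (fun j => `|entry g i j| ^+ 2 : R[i]^o).
  by apply/funext => j; rewrite normcJ.
exact: entry_row_norm.
Qed.

End CorrelationSpace.

(** * Pulling back along an automorphism *)

Section Pullback.
Context {R : realType} {A : cstarAlgType R}.

Lemma star_hom_inverse (f f' : A -> A) :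
  is_star_hom f -> cancel f f' -> cancel f' f -> is_star_hom f'.
Proof.
move=> [flin fM f1 fS] ff' f'f; split.
- by move=> k a b; rewrite -[RHS]ff' flin !f'f.
- by move=> a b; rewrite -[RHS]ff' fM !f'f.
- by rewrite -f1 ff'.
- by move=> a; rewrite -[RHS]ff' fS f'f.
Qed.

Lemma state_comp (f : A -> A) (omega : A -> R[i]) :
  is_star_hom f -> is_state omega -> is_state (omega \o f).
Proof.
move=> [flin fM f1 fS] [olin opos o1]; split => [k a b|a|] /=.
- by rewrite flin olin.
- by rewrite fM fS; exact: opos.
- by rewrite f1.
Qed.

Lemma gns_comp (f f' : A -> A) (omega : A -> R[i]) (H : hilbertType R)
    (pi : A -> H -> H) (Omega : H) :
  is_star_hom f -> cancel f' f ->
  is_gns omega pi Omega -> is_gns (omega \o f) (pi \o f) Omega.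
Proof.
move=> [flin fM f1 fS] f'f [[piC pi_lin piM pi_adj pi1] dense_pi omegaE].
split => [|O O0 Oo|a] /=; last exact: omegaE.
  split => //= [k a b x|a b x|a x y|x].
  - by rewrite flin pi_lin.
  - by rewrite fM piM.
  - by rewrite fS pi_adj.
  - by rewrite f1 pi1.
have [y [Oy [a _ ay]]] := dense_pi O O0 Oo.
by exists y; split => //; exists (f' a) => //=; rewrite f'f.
Qed.

Lemma state_equiv_comp (f f' : A -> A) (omega omega' : A -> R[i]) :
  is_star_hom f -> cancel f' f ->
  state_equiv omega omega' -> state_equiv (omega \o f) (omega' \o f).
Proof.
move=> fhom f'f [H [H' [pi [pi' [W [W' [gns gns' [U [Ulin Udot Usurj Upi]]]]]]]]].
exists H, H', (pi \o f), (pi' \o f), W, W'.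
split; [exact: (gns_comp fhom f'f gns) | exact: (gns_comp fhom f'f gns') |].
by exists U; split => // a x; exact: Upi.
Qed.

Lemma corr_space_comp (n : enat) (s : idx n -> A) (f : A -> A)
    (H : hilbertType R) (pi : A -> H -> H) (Omega : H) :
  is_star_hom f -> corr_space s (pi \o f) Omega = corr_space (f \o s) pi Omega.
Proof.
move=> [_ fM f1 fS]; congr (closed_span (_ @` _)); apply/funext => J /=.
rewrite fS; congr (pi (star _) _).
by elim: J => [|j J IH] //=; rewrite fM IH.
Qed.

Lemma orthogonal_isometries_comp (n : enat) (s : idx n -> A) (f : A -> A) :
  is_star_hom f -> orthogonal_isometries s -> orthogonal_isometries (f \o s).
Proof.
move=> [flin fM f1 fS] ss i j /=; rewrite -fS -fM ss; case: ifP => // _.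
by have := flin (-1) 0 0; rewrite !scaler0 !addr0 scaleN1r addNr.
Qed.

End Pullback.

(** * Invariance of the dimensions *)

Section Invariance.
Context {R : realType} {n : enat} {A : cstarAlgType R}.
Context {s : idx n -> A} {f f' : A -> A}.
Hypotheses (fhom : is_star_hom f) (ff' : cancel f f') (f'f : cancel f' f).
Hypothesis corr_f : forall (H : hilbertType R) (pi : A -> H -> H) (Omega : H),
  is_star_rep pi -> corr_space (f \o s) pi Omega = corr_space s pi Omega.

Lemma cdim_comp (omega : A -> R[i]) : cdim s (omega \o f) = cdim s omega.
Proof.
have f'hom := star_hom_inverse fhom ff' f'f.
congr (xget None _); apply/seteqP; split => d [H [pi [W [gns dim]]]].
  have := gns_comp f'hom ff' gns.
  have -> : (omega \o f) \o f' = omega by apply/funext => a /=; rewrite f'f.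
  move=> gns'; exists H, (pi \o f'), W; split => //.
  have [rep' _ _] := gns'; rewrite -corr_f // -corr_space_comp //.
  by have -> : (pi \o f') \o f = pi by apply/funext => a /=; rewrite ff'.
have gns' := gns_comp fhom f'f gns.
exists H, (pi \o f), W; split => //.
by have [rep _ _] := gns; rewrite corr_space_comp // corr_f.
Qed.

Lemma kappa_comp (omega : A -> R[i]) : kappa s (omega \o f) = kappa s omega.
Proof.
have f'hom := star_hom_inverse fhom ff' f'f.
congr enat_min; apply/seteqP; split => _ [omega' [st eqv] <-].
  exists (omega' \o f'); last first.
    rewrite -cdim_comp; congr (cdim s _).
    by apply/funext => a /=; rewrite ff'.
  split; first exact: state_comp.
  have := state_equiv_comp f'hom ff' eqv.
  by have -> : (omega \o f) \o f' = omega by apply/funext => a /=; rewrite f'f.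
exists (omega' \o f); last exact: cdim_comp.
by split; [exact: state_comp | exact: (state_equiv_comp fhom f'f eqv)].
Qed.

End Invariance.

Theorem proposition1p2 (R : realType) (n : enat) (A : cstarAlgType R)
    (s : idx n -> A) (alpha : unitary_group R n -> A -> A) (omega : A -> R[i])
    (hn : enat_le (Some 2%N) n)
    (hs : is_cuntz_algebra s)
    (halpha : is_standard_action s alpha)
    (homega : is_state omega) :
  (forall g : unitary_group R n, cdim s (omega \o alpha g) = cdim s omega) /\
  (forall g : unitary_group R n, kappa s (omega \o alpha g) = kappa s omega).
Proof.
have [[ss _] _ _] := hs.
have corr_alpha g (H : hilbertType R) (pi : A -> H -> H) (Omega : H) :
    is_star_rep pi ->
    corr_space (alpha g \o s) pi Omega = corr_space s pi Omega.
  have [[ghom _] gs] := halpha g => hpi.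
  by apply: (corr_space_unitary_mix hpi Omega ss _ gs);
    exact: orthogonal_isometries_comp.
split=> g; have [[ghom [g' gg' g'g]] _] := halpha g.
  exact: (cdim_comp ghom gg' g'g (@corr_alpha g)).
exact: (kappa_comp ghom gg' g'g (@corr_alpha g)).
Qed.
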